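(* Let $s\geq 3$ be an integer. There exists a constant $c>0$ depending only on $s$ such that for every integer $m \geq 2$ and every graph $G$ with $m$ edges and no isolated vertices, $$r(K_s,G) \leq c\, \frac{m^{\frac{s-1}{2}}}{(\log m)^{\frac{s-3}{2}}}.$$
   Context: For graphs $H$ and $G$, the Ramsey number $r(H,G)$ is the smallest positive integer $n$ such that every red-blue coloring of the edges of the complete graph $K_n$ on $n$ vertices contains either a red copy of $H$ or a blue copy of $G$. $K_s$ denotes the complete graph on $s$ vertices. Logarithms are natural. *)

(* Defs.v *)
From mathcomp Require Import all_boot.
Set Implicit Arguments. Unset Strict Implicit. Unset Printing Implicit Defensive.

Definition simple_graph (V : finType) (e : rel V) : Prop :=
  symmetric e /\ irreflexive e.

Definition num_edges (V : finType) (e : rel V) : nat :=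
  #|[set A : {set V} | [exists x, exists y, (A == [set x; y]) && e x y]]|.

Definition no_isolated (V : finType) (e : rel V) : Prop :=
  forall x : V, exists y : V, e x y.

(* A red/blue colouring of the edges of K_n is given by its red relation
   (symmetric); an edge {i,j}, i != j, is blue iff it is not red. *)
Definition red_clique (n s : nat) (red : rel 'I_n) : Prop :=
  exists S : {set 'I_n}, #|S| = s /\
    forall x y, x \in S -> y \in S -> x != y -> red x y.

Definition blue_copy (n : nat) (red : rel 'I_n) (V : finType) (e : rel V) : Prop :=
  exists f : V -> 'I_n, injective f /\ forall x y, e x y -> ~~ red (f x) (f y).

Definition ramsey_prop (s : nat) (V : finType) (e : rel V) (n : nat) : Prop :=
  forall red : rel 'I_n, symmetric red -> red_clique s red \/ blue_copy red e.

(* Main.v *)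
Require Import Defs.
From mathcomp Require Import all_boot all_order all_algebra.
From mathcomp Require Import lra zify.
From Stdlib Require Import Classical.
Set Implicit Arguments. Unset Strict Implicit. Unset Printing Implicit Defensive.

(* Write [g = sqrt (m / ln m)]; the bound for [s = j + 3] is [O(m g^j)]. In a
   colouring without a red [K_s] and without a blue [G], red degrees are at most
   [D = O(m g^(j-1))], the bound for [s - 1]. Hence vertices of [G] can be embedded
   in blue greedily as long as some remaining vertex has degree at most about [g].
   What is left has minimum degree at least [g], so at most [2 m / g] vertices, and
   it fits into any red-independent set of that size. Such a set exists: the
   codegrees of red edges are bounded by the estimate for [s - 2] (for [s = 4],
   common red neighbourhoods are themselves independent), smaller than [D] by a
   power of [m], so a graph of order [N] has independence number of order
   [N ln m / D] by Shearer's random independent set argument. For [s = 3] red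
   neighbourhoods are blue cliques and embedding a minimum degree vertex last
   already gives [4 m]. *)

(** * Independent sets in locally sparse graphs *)

Section LocallySparse.
Import Order.TTheory GRing.Theory Num.Theory.
Local Open Scope ring_scope.

Section Weights.
Variables (F : realFieldType) (T : finType).
Implicit Types (A B I J U : {set T}) (l : F).

Lemma sum_powerset_expr l A :
  \sum_(I : {set T} | I \subset A) l ^+ #|I| = (1 + l) ^+ #|A|.
Proof.
rewrite exprDn (partition_big (fun I : {set T} => (inord #|I| : 'I_#|A|.+1)) xpredT) //=.
apply: eq_bigr => i _.
rewrite expr1n mul1r -cards_draws -sumr_const.
apply: congr_big => // I.
  rewrite inE; apply: andb_id2l => sIA.
  by rewrite -val_eqE /= inordK // ltnS subset_leq_card.
by case/andP => sIA /eqP <-; rewrite inordK // ltnS subset_leq_card.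
Qed.

(** Such an [I] is determined by [I :&: A], and its weight is [l ^+ #|J|] times that of [I :&: A];
    the sum is empty when [J] meets [A]. *)
Lemma sum_fiber_setD_le l A J : 0 <= l ->
  \sum_(I : {set T} | I :\: A == J) l ^+ #|I| <= l ^+ #|J| * (1 + l) ^+ #|A|.
Proof.
move=> l0; rewrite -sum_powerset_expr mulr_sumr.
rewrite (partition_big (fun I => I :&: A) (fun B => B \subset A)) /=; last first.
  by move=> I _; apply: subsetIr.
apply: ler_sum => B sBA.
have -> : l ^+ #|J| * l ^+ #|B| = \sum_(I | I == J :|: B) l ^+ (#|J| + #|B|).
  by rewrite big_pred1_eq exprD.
rewrite [leLHS]big_mkcond [leRHS]big_mkcond /=.
apply: ler_sum => I _; case: ifP => [/andP[/eqP <- /eqP <-]|_].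
  by rewrite setUC setID eqxx addnC cardsID.
by case: ifP => // _; rewrite exprn_ge0.
Qed.
End Weights.

(** A Bernoulli-type bound in place of an exponential: at [j * l = 1/2] it gives
    [(1 + l) ^+ j <= 2]. *)
Lemma expr1D_le (F : realFieldType) (l : F) j : 0 <= l ->
  (1 + l) ^+ j * (1 - j%:R * l) <= 1.
Proof.
move=> l0; elim: j => [|j IH]; first by rewrite expr0 mul0r subr0 mul1r.
apply: le_trans IH; rewrite exprSr -mulrA ler_wpM2l ?exprn_ge0 ?addr_ge0 //.
have j0 : 0 <= j%:R :> F by [].
rewrite -natr1; nra.
Qed.

Lemma sum_subpred_le (F : numDomainType) (I : finType) (P Q : pred I) (f : I -> F) :
  subpred P Q -> (forall i, Q i -> 0 <= f i) ->
  \sum_(i | P i) f i <= \sum_(i | Q i) f i.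
Proof.
move=> PQ f0; rewrite [leLHS]big_mkcond [leRHS]big_mkcond ler_sum // => i _.
case: ifP => [/PQ -> //|_]; by case: ifP => // /f0.
Qed.

Section HardCore.
Variables (F : realFieldType) (T : finType) (U : {set T}) (e : rel T).
Hypotheses (eC : symmetric e) (e0 : irreflexive e).
Implicit Types (I J A B : {set T}) (u v : T) (k t D : nat).

Definition nbrs (U : {set T}) (e : rel T) v := [set u in U | e v u].
Definition indep (U : {set T}) (e : rel T) I :=
  (I \subset U) && [forall x in I, forall y in I, ~~ e x y].

Lemma indepP I : reflect ({subset I <= U} /\ {in I &, forall x y, ~~ e x y})
  (indep U e I).
Proof.
apply: (iffP andP) => -[/subsetP sIU H]; split=> //.
  by move=> x y xI yI; move/forall_inP: H => /(_ x xI)/forall_inP /(_ y yI).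
by apply/forall_inP=> x xI; apply/forall_inP=> y yI; apply: H.
Qed.

Section Local.
Variables (v : T) (J : {set T}) (l : F) (k t D : nat).
Let nb := nbrs U e v.
(** Conditioning on the trace [J] outside the closed neighbourhood of [v]: members of this fibre
    differ only inside [v |: nb]. *)
Let A := [pred I | indep U e I && (I :\: (v |: nb) == J)].
Hypotheses (vU : v \in U) (l0 : 0 <= l) (l1 : l <= 1).
Hypothesis (iJ : indep U e J) (dJ : J :\: (v |: nb) == J).
Hypothesis (cod : forall u, u \in nb -> (#|nb :&: nbrs U e u| < k)%N).

Let S := [set u in nb | [forall y in J, ~~ e u y]].
Let Y := \sum_(I in A | v \notin I) l ^+ #|I|.

Lemma fiber_base x : x \in J -> [/\ x \in U, x != v & ~~ e v x].
Proof.
have/indepP[sJ _] := iJ; move=> xJ; move: (xJ).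
rewrite -{1}(eqP dJ) !inE sJ // negb_or xJ andbT => /andP[-> /= ->].
by split.
Qed.

Lemma fiber_avail I x : A I -> v \notin I -> x \in I -> x \in J \/ x \in S.
Proof.
case/andP => /indepP[sI nI] /eqP eJ vI xI.
case: (boolP (x \in J)) => [|xJ]; [by left|right].
have xnv : x != v by apply: contraNneq vI => <-.
move: xJ; rewrite -eJ !inE xI andbT negbK (negbTE xnv) /= => -> /=.
by apply/forall_inP => y; rewrite -eJ inE => /andP[_ yI]; apply: nI.
Qed.

Lemma fiber_sub I : A I -> {subset J <= I}.
Proof. by case/andP => _ /eqP <- x; rewrite inE => /andP[]. Qed.

Lemma availP x : x \in S -> [/\ x \in U, e v x & {in J, forall y, ~~ e x y}].
Proof. by rewrite !inE => /andP[/andP[-> ->] /forall_inP]; split. Qed.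

(** An independent set containing [v] misses all of [nb], so [v |: J] is the only member of the
    fibre that contains [v]. *)
Lemma sum_fiber_in : \sum_(I in A | v \in I) l ^+ #|I| = l * l ^+ #|J|.
Proof.
have vJ : v \notin J by apply/negP => /fiber_base[]; rewrite eqxx.
rewrite (eq_bigl (pred1 (v |: J))) ?big_pred1_eq ?cardsU1 ?vJ ?exprS //.
move=> I /=; apply/andP/eqP => [[/andP[/indepP[sI nI] /eqP <-] vI]|->].
  apply/setP => x; rewrite !inE.
  have [->|_] //= := eqVneq x v.
  have [xI|] := boolP (x \in I); last by rewrite andbF.
  by rewrite (negbTE (nI v x vI xI)) andbF.
split; last by rewrite setU11.
have/indepP[sJ nJ] := iJ.
apply/andP; split.
  apply/indepP; split=> [x|x y].
    by case/setU1P => [->|/fiber_base[]].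
  case/setU1P => [->|xJ]; case/setU1P => [->|yJ]; rewrite ?e0 //.
  - by case: (fiber_base yJ).
  - by rewrite eC; case: (fiber_base xJ).
  by apply: nJ.
apply/eqP/setP=> x; rewrite !inE.
have [->|xv] /= := eqVneq x v; first by rewrite (negbTE vJ).
case: (boolP (x \in J)) => [/fiber_base[_ _ /negbTE ->]|_]; last by rewrite andbF.
by rewrite andbF.
Qed.

Lemma fiber_notin_le : Y <= l ^+ #|J| * (1 + l) ^+ #|S|.
Proof.
apply: le_trans (sum_fiber_setD_le S J l0).
apply: sum_subpred_le => [I|I _]; last exact: exprn_ge0.
case/andP=> AI vI; apply/eqP/setP => x; rewrite inE.
apply/andP/idP=> [[xS xI]|xJ].
  by case: (fiber_avail AI vI xI) => // /idP; rewrite (negbTE xS).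
split; last exact: (fiber_sub AI).
by apply/negP => /availP[_ evx _]; case: (fiber_base xJ); rewrite evx.
Qed.

Lemma fiber_notin_ge : l ^+ #|J| <= Y.
Proof.
have vJ : v \notin J by apply/negP => /fiber_base[]; rewrite eqxx.
have AJ : (J \in A) && (v \notin J) by rewrite vJ andbT; apply/andP.
by rewrite /Y (bigD1 J AJ) /= lerDl sumr_ge0 // => I _; apply: exprn_ge0.
Qed.

(* The map [I |-> u |: (I :\: B)] sends the fibre into its members containing
   [u]; it is at most [(1 + l) ^+ k]-to-one in weight. *)
Lemma fiber_switch u : u \in S ->
  l * Y <= (1 + l) ^+ k * \sum_(I in A | (v \notin I) && (u \in I)) l ^+ #|I|.
Proof.
move=> uS; have [uU evu uJ] := availP uS.
have unb : u \in nb by rewrite inE uU.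
have uv : u != v by apply: contraTneq evu => ->; rewrite e0.
(* Removing [B] from [I] removes every conflict with [u]; the strict codegree bound leaves room for
   [u] itself in [#|B| <= k]. *)
pose B := u |: (nb :&: nbrs U e u).
have cB : (#|B| <= k)%N.
  by rewrite cardsU1 !inE e0 !andbF /= add1n cod.
pose phi I := u |: (I :\: B).
have uB : u \in B by rewrite setU11.
have phiA I : (I \in A) && (v \notin I) ->
    (phi I \in A) && ((v \notin phi I) && (u \in phi I)).
  case/andP=> AI vI; apply/andP; split; last first.
    by rewrite setU11 andbT in_setU1 in_setD (negbTE vI) andbF orbF eq_sym.
  have/andP[/indepP[sI nI] _] := AI.
  have H x : x \in I :\: B -> ~~ e u x.
    rewrite inE => /andP[xB xI].
    case: (fiber_avail AI vI xI) => [/uJ //|/availP[xU evx _]].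
    by apply: contra xB => eux; rewrite !inE xU evx eux orbT.
  apply/andP; split.
    apply/indepP; split=> [x|x y].
      by case/setU1P => [->//|]; rewrite inE => /andP[_ /sI].
    case/setU1P => [->|xJ]; case/setU1P => [->|yJ]; rewrite ?e0 //.
    - exact: H.
    - by rewrite eC; apply: H.
    by apply: nI; [move: xJ|move: yJ]; rewrite inE => /andP[].
  apply/eqP/setP=> x; rewrite in_setD.
  apply/andP/idP => [[xn]|xJ].
    case/setU1P => [xu|]; first by move: xn; rewrite xu inE unb orbT.
    rewrite inE => /andP[_ xI].
    by case: (fiber_avail AI vI xI) => // /availP[xU evx _]; move: xn;
       rewrite !inE xU evx orbT.
  have [xU xv evx] := fiber_base xJ.
  split; first by rewrite !inE negb_or xv (negbTE evx) andbF.
  by rewrite !inE (negbTE evx) andbF /= orbF (fiber_sub AI) // andbT orbN.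
rewrite /Y (partition_big phi
  (fun I => (I \in A) && ((v \notin I) && (u \in I)))) //= !mulr_sumr.
apply: ler_sum => I' /andP[_ /andP[_ uI']].
(* All preimages of [I'] agree with [I' :\ u] outside [B]; the spare factor [l] restores the weight
   of [u]. *)
apply: (@le_trans _ _ (l * (l ^+ #|I' :\ u| * (1 + l) ^+ #|B|))).
  apply: ler_wpM2l => //; apply: le_trans (sum_fiber_setD_le B (I' :\ u) l0).
  apply: sum_subpred_le => [I|I _]; last exact: exprn_ge0.
  case/andP=> _ /eqP <-; apply/eqP/setP => x; rewrite !inE.
  by case: eqVneq.
rewrite mulrA -exprS (cardsD1 u I') uI' add1n mulrC.
by rewrite ler_wpM2r ?exprn_ge0 // ler_weXn2l // lerDl.
Qed.

(** Either few neighbours of [v] are available and [v] itself carries enough weight, or many are and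
    each contributes at least [l / 2 * Y]. The coefficient [D] on [v] balances the two cases. *)
Lemma fiber_weight_ge : (0 < k)%N -> k%:R * l = 2^-1 -> (k * 4 ^ t <= D)%N ->
  t%:R / 8 * \sum_(I in A) l ^+ #|I| <=
  \sum_(I in A) l ^+ #|I| * (D * (v \in I) + #|nb :&: I|)%:R.
Proof.
move=> k0 kl kD; set W := \sum_(I in A) _; set X := \sum_(I in A) _.
have wJ0 : 0 <= l ^+ #|J| by rewrite exprn_ge0.
have YJ := fiber_notin_ge; have Y0 := le_trans wJ0 YJ.
have hk : (1 + l) ^+ k <= 2.
  by have := expr1D_le k l0; rewrite kl => h; nra.
have WY : W <= 2 * Y.
  rewrite /W (bigID (fun I => v \in I)) /= sum_fiber_in -/Y.
  by have := ler_wpM2r wJ0 l1; rewrite mul1r; lra.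
(* The first term comes from the set containing [v], the second from [fiber_switch] summed over
   [S]. *)
have XE : D%:R * (l * l ^+ #|J|) + #|S|%:R * (l / 2 * Y) <= X.
  rewrite /X (bigID (fun I => v \in I)) /= lerD //.
    rewrite -sum_fiber_in mulr_sumr; apply: ler_sum => I /andP[_ ->].
    by rewrite mulrC ler_wpM2l ?exprn_ge0 // muln1 ler_nat leq_addr.
  apply: (@le_trans _ _ (\sum_(u in S)
     \sum_(I in A | (v \notin I) && (u \in I)) l ^+ #|I|)).
    rewrite mulr_natl -sumr_const; apply: ler_sum => u uS.
    have := fiber_switch uS; set Z := \sum_(I | _) _ => h.
    have Z0 : 0 <= Z by apply: sumr_ge0 => I _; apply: exprn_ge0.
    by have := ler_wpM2r Z0 hk; lra.
  rewrite (exchange_big_dep (fun I => (I \in A) && (v \notin I))) /=; last first.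
    by move=> u I _ /and3P[-> ->].
  apply: ler_sum => I AI; rewrite (andP AI).1 (negbTE (andP AI).2) /=.
  rewrite muln0 add0n sumr_const -[leLHS]mulr_natr ler_wpM2l ?exprn_ge0 // ler_nat.
  apply: subset_leq_card; apply/subsetP => u.
  by case/andP=> /availP[uU evu _] uI; rewrite !inE uU evu.
have t0 : 0 <= t%:R :> F by [].
(* With few available vertices [Y] is at most [2 ^+ t * l ^+ #|J|], while [k * 4 ^ t <= D] makes
   [2 * D * l] at least [4 ^+ t]. *)
have [xkt|xkt] := leqP #|S| (k * t).
  have hY : Y <= l ^+ #|J| * 2 ^+ t.
    apply: le_trans fiber_notin_le _; rewrite ler_wpM2l //.
    apply: (@le_trans _ _ ((1 + l) ^+ (k * t))).
      by rewrite ler_weXn2l // lerDl.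
    by rewrite exprM lerXn2r // nnegrE ?exprn_ge0 // addr_ge0.
  have hD : 2 ^+ t * 2 ^+ t <= 2 * (D%:R * l).
    have : ((k * 4 ^ t)%N%:R * l <= D%:R * l :> F) by rewrite ler_wpM2r // ler_nat.
    by rewrite natrM mulrAC kl natrX -exprMn -natrM; lra.
  have ht : t%:R <= 2 ^+ t :> F.
    by rewrite -natrX ler_nat ltnW // ltn_expl.
  have h1 : t%:R * Y <= 2 * (D%:R * l) * l ^+ #|J|.
    apply: (@le_trans _ _ (2 ^+ t * (l ^+ #|J| * 2 ^+ t))).
      by apply: ler_pM.
    by have := ler_wpM2r wJ0 hD; lra.
  have h2 : 0 <= #|S|%:R * (l / 2 * Y) by rewrite !mulr_ge0 // invr_ge0.
  have := ler_wpM2l t0 WY; have := mulr_ge0 t0 Y0; lra.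
have hx : t%:R <= 2 * (#|S|%:R * l).
  have : ((k * t)%N%:R * l <= #|S|%:R * l) by rewrite ler_wpM2r // ler_nat ltnW.
  by rewrite natrM mulrAC kl; lra.
have h1 := ler_wpM2r Y0 hx.
have h2 : 0 <= D%:R * (l * l ^+ #|J|) by rewrite !mulr_ge0.
have := ler_wpM2l t0 WY; lra.
Qed.
End Local.
End HardCore.

(* Shearer's argument for the hard-core model of fugacity [1 / (2 k)]: at this
   density a set of at most [k] common neighbours has total weight [O(1)], so a
   neighbourhood behaves as if it were independent. *)
Lemma locally_sparse_indep (T : finType) (U : {set T}) (e : rel T) (k t D a : nat) :
  symmetric e -> irreflexive e -> (0 < k)%N -> (k * 4 ^ t <= D)%N ->
  {in U, forall v, #|nbrs U e v| <= D}%N ->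
  {in U &, forall v u, e v u -> #|nbrs U e v :&: nbrs U e u| < k}%N ->
  (forall I, indep U e I -> #|I| <= a)%N ->
  (#|U| * t <= 16 * D * a)%N.
Proof.
move=> eC e0 k0 kD degU codU indU.
pose l : rat := (2 * k%:R)^-1.
have kr : 1 <= k%:R :> rat by rewrite ler1n.
have kl : k%:R * l = 2^-1 by rewrite /l invfM mulrCA divff ?mulr1 // pnatr_eq0 -lt0n.
have l0 : 0 < l by rewrite /l invr_gt0; lra.
have l1 : l <= 1 by nra.
pose W := \sum_(I | indep U e I) l ^+ #|I|.
have W0 : 0 < W.
  have i0 : indep U e set0.
    by apply/indepP; split=> [x|x y]; rewrite inE.
  rewrite /W (bigD1 set0 i0) /= ltr_pwDl ?exprn_gt0 // sumr_ge0 // => I _.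
  by rewrite exprn_ge0 // ltW.
have wge0 I : 0 <= l ^+ #|I| by rewrite exprn_ge0 // ltW.
(* The independent sets are split by their trace outside the closed neighbourhood of [v], and the
   fibre estimate is summed over all traces. *)
have low v : v \in U -> t%:R / 8 * W <=
    \sum_(I | indep U e I) l ^+ #|I| * (D * (v \in I) + #|nbrs U e v :&: I|)%:R.
  move=> vU; pose B := v |: nbrs U e v.
  pose Q J := indep U e J && (J :\: B == J).
  have QP I : indep U e I -> Q (I :\: B).
    move=> /indepP[sI nI]; apply/andP; split.
      apply/indepP; split=> [x|x y]; rewrite !in_setD.
        by case/andP=> _ /sI.
      by move=> /andP[_ xI] /andP[_ yI]; apply: nI.
    by rewrite setDDl setUid.
  rewrite /W (partition_big (fun I => I :\: B) Q QP) /= mulr_sumr.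
  rewrite [leRHS](partition_big (fun I => I :\: B) Q QP) /=.
  apply: ler_sum => J /andP[iJ dJ].
  apply: (fiber_weight_ge eC e0 vU (ltW l0) l1 iJ dJ _ k0 kl kD) => u.
  by rewrite inE => /andP[uU]; apply: codU.
(* Double counting: for a fixed [I] the local quantities sum to at most [2 * D * #|I|], as each
   vertex of [I] has at most [D] neighbours. Factors [8] and [2] give the final [16]. *)
have : \sum_(v in U) t%:R / 8 * W <= (2 * D * a)%N%:R * W.
  apply: le_trans (ler_sum _ low) _.
  rewrite exchange_big /= mulr_sumr; apply: ler_sum => I iI.
  rewrite -mulr_sumr mulrC ler_wpM2r // -natr_sum ler_nat big_split /=.
  have [sI nI] := indepP _ _ _ iI.
  have hd : (\sum_(v in U) #|nbrs U e v :&: I| <= D * #|I|)%N.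
    have E v : #|nbrs U e v :&: I| = (\sum_(u in I) (u \in nbrs U e v))%N.
      rewrite setIC -sum1_card; under eq_bigl do rewrite in_setI.
      by rewrite big_mkcondr /=; apply: eq_bigr => u _; case: (u \in _).
    under eq_bigr do rewrite E.
    rewrite exchange_big /= mulnC -sum_nat_const; apply: leq_sum => u uI.
    apply: leq_trans (degU u (sI u uI)).
    rewrite -sum1_card big_mkcond [leqRHS]big_mkcond; apply: leq_sum => v _.
    by rewrite !inE (sI u uI) eC; case: (v \in U).
  have hI : (\sum_(v in U) D * (v \in I) = D * #|I|)%N.
    rewrite -big_distrr /= -sum1_card; congr (D * _)%N.
    rewrite big_mkcond [RHS]big_mkcond; apply: eq_bigr => v _.
    by case: (boolP (v \in I)) => [/sI ->|]//; case: ifP.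
  have := leq_mul (leqnn D) (indU _ iI); lia.
rewrite sumr_const -[leLHS]mulr_natl mulrA ler_pM2r // => h.
by rewrite -(ler_nat rat) !natrM in h *; lra.
Qed.
End LocallySparse.

(** * Cliques and blue copies inside vertex subsets *)

Definition has_clique (W : finType) (red : rel W) (s : nat) (U : {set W}) : Prop :=
  exists S : {set W}, [/\ S \subset U, #|S| = s &
    {in S &, forall x y, x != y -> red x y}].

(** A blue embedding of the subgraph induced on [P]; [f] is total, but its values outside [P] are
    arbitrary. *)
Definition has_blue (W : finType) (red : rel W) (U : {set W})
    (V : finType) (e : rel V) (P : {set V}) : Prop :=
  exists f : V -> W, [/\ {in P &, injective f}, {in P, forall x, f x \in U} &
    {in P &, forall x y, e x y -> ~~ red (f x) (f y)}].

(** Hosts are subsets of arbitrary finite types, so that the property applies directly to red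
    neighbourhoods. *)
Definition arrows (s : nat) (V : finType) (e : rel V) (n : nat) : Prop :=
  forall (W : finType) (red : rel W) (U : {set W}), symmetric red ->
    (n <= #|U|)%N -> has_clique red s U \/ has_blue red U e setT.

(** A colouring may relate a vertex to itself; dropping the diagonal gives an irreflexive red
    graph. *)
Definition loopless (W : finType) (red : rel W) : rel W :=
  [rel x y | (x != y) && red x y].

Lemma arrows_ramsey s (V : finType) (e : rel V) n :
  arrows s e n -> ramsey_prop s e n.
Proof.
move=> A red redC; have := A 'I_n red setT redC.
rewrite cardsT card_ord => /(_ (leqnn n)) [[S [_ cS rS]]|[f [fI _ fe]]].
  by left; exists S.
right; exists f; split=> [x y|x y]; first by apply: fI.
by apply: fe.
Qed.

Section Edges.
Variables (V : finType) (e : rel V).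
Hypothesis (eG : simple_graph e).

(** Handshake count of pairs of a vertex and an edge through it: [u |-> [set x; u]] is injective on
    the neighbours of [x], and an edge has at most two ends. *)
Lemma sum_degree_le : (\sum_x #|[set u | e x u]| <= 2 * num_edges e)%N.
Proof.
have [eC e0] := eG.
set E := [set A : {set V} | [exists x, exists y, (A == [set x; y]) && e x y]].
apply: (@leq_trans (\sum_x #|[set A in E | x \in A]|)).
  apply: leq_sum => x _.
  rewrite -(@card_in_imset _ _ (fun u => [set x; u])); last first.
    move=> u u'; rewrite !inE => exu exu' /setP /(_ u).
    rewrite !inE eqxx orbT => /esym /orP[/eqP ux|/eqP //].
    by rewrite ux e0 in exu.
  apply: subset_leq_card; apply/subsetP=> A /imsetP[u].
  rewrite !inE => exu ->; rewrite !inE eqxx andbT.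
  by apply/existsP; exists x; apply/existsP; exists u; rewrite eqxx.
under eq_bigr do rewrite -sum1_card; under eq_bigr do under eq_bigl do rewrite in_set.
rewrite (exchange_big_dep (mem E)) /=; last by move=> x A _ /andP[].
rewrite mulnC /num_edges -/E -sum_nat_const; apply: leq_sum => A.
rewrite inE => /existsP[x /existsP[y /andP[/eqP -> _]]].
rewrite sum1_card; apply: leq_trans (_ : #|[set x; y]| <= 2)%N; last first.
  by rewrite cards2; case: (_ != _).
by apply: subset_leq_card; apply/subsetP => z /andP[].
Qed.

Lemma card_mul_degree_le (P : {set V}) d :
  {in P, forall v, d <= #|[set u in P | e v u]|}%N ->
  (#|P| * d <= 2 * num_edges e)%N.
Proof.
move=> H; apply: leq_trans sum_degree_le.
rewrite -sum_nat_const big_mkcond; apply: leq_sum => v _.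
case: ifP => // /H /leq_trans; apply.
by apply: subset_leq_card; apply/subsetP => z; rewrite !inE => /andP[].
Qed.

Lemma no_isolated_card_le : no_isolated e -> (#|V| <= 2 * num_edges e)%N.
Proof.
move=> H; rewrite -cardsT -[X in (X <= _)%N]muln1.
apply: card_mul_degree_le => v _; have [u evu] := H v.
by apply/card_gt0P; exists u; rewrite !inE.
Qed.
End Edges.

(** * Greedy blue embeddings and the recursion step *)

Section Embed.
Variables (W : finType) (red : rel W) (V : finType) (e : rel V).
Hypotheses (redC : symmetric red) (eG : simple_graph e).
Implicit Types (U X I : {set W}) (P Q : {set V}) (w : W) (v : V) (D d h k t s : nat).
Let radj := loopless red.

Lemma looplessC : symmetric radj.
Proof. by move=> x y; rewrite /radj /loopless /= eq_sym redC. Qed.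

Lemma loopless_irr : irreflexive radj.
Proof. by move=> x; rewrite /radj /loopless /= eqxx. Qed.

Lemma has_blueS U X P Q : X \subset U -> Q \subset P ->
  has_blue red X e P -> has_blue red U e Q.
Proof.
move=> /subsetP sXU /subsetP sQP [f [fI fX fe]]; exists f.
split=> [x y xQ yQ|x xQ|x y xQ yQ]; last by apply: fe; apply: sQP.
  by apply: fI; apply: sQP.
by apply/sXU/fX/sQP.
Qed.

Lemma has_cliqueS U X s : X \subset U -> has_clique red s X -> has_clique red s U.
Proof. by move=> sXU [S [sS cS rS]]; exists S; split=> //; apply: subset_trans sXU. Qed.

Lemma nbrs_sub U w : nbrs U radj w \subset U.
Proof. by apply/subsetP => x; rewrite inE => /andP[]. Qed.

(** The clique is located in [w |: X], so that the step can be repeated inside another red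
    neighbourhood. *)
Lemma has_clique_nbrs U X w s : X \subset U -> w \in U -> X \subset nbrs U radj w ->
  has_clique red s X -> has_clique red s.+1 (w |: X).
Proof.
move=> /subsetP sXU wU /subsetP sX [S [/subsetP sS cS rS]]; exists (w |: S).
have wr x : x \in S -> (w != x) && red w x.
  by move/sS/sX; rewrite inE => /andP[].
split.
- by rewrite setUS //; apply/subsetP.
- rewrite cardsU1 cS; suff -> : w \notin S by [].
  by apply/negP => /wr; rewrite eqxx.
move=> x y /setU1P[->|xS] /setU1P[->|yS]; rewrite ?eqxx //.
- by case/andP: (wr _ yS).
- by rewrite redC; case/andP: (wr _ xS).
by apply: rS.
Qed.

Lemma has_blue_indep U I P : (0 < #|U|)%N -> indep U radj I -> (#|P| <= #|I|)%N ->
  has_blue red U e P.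
Proof.
move=> /card_gt0P[w0 _] /indepP[sI nI] cPI; have [_ e0] := eG.
(* Vertices are matched by rank; [w0] is only a default, since ranks in [P] stay below [#|I|]. *)
pose f v := nth w0 (enum I) (index v (enum P)).
have lt v : v \in P -> (index v (enum P) < size (enum I))%N.
  by move=> vP; rewrite -cardE; apply: leq_trans cPI; rewrite cardE index_mem mem_enum.
have fI v : v \in P -> f v \in I by move=> /lt vP; rewrite -mem_enum mem_nth.
have inj : {in P &, injective f}.
  move=> x y xP yP /eqP; rewrite nth_uniq ?enum_uniq ?lt // => /eqP.
  by apply: (index_inj x); rewrite mem_enum.
exists f; split=> // [x /fI /sI //|x y xP yP exy].
have /negP := nI _ _ (fI _ xP) (fI _ yP); rewrite /radj /loopless /= => H.
apply/negP => r; apply: H; rewrite r andbT.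
by apply/eqP => /(inj _ _ xP yP) xy; rewrite xy e0 in exy.
Qed.

(** The vertex [v] must avoid at most [#|P| - 1] used images and the red neighbourhoods of the
    images of its at most [d] neighbours; this leaves a free place in [U]. *)
Lemma has_blue_extend U P v d D : v \in P -> has_blue red U e (P :\ v) ->
  (#|[set u in P | e v u]| <= d)%N -> {in U, forall w, #|nbrs U radj w| <= D}%N ->
  (#|P| + d * D <= #|U|)%N -> has_blue red U e P.
Proof.
move=> vP [f [fI fU fe]] degv degU cP; have [eC e0] := eG.
pose N := [set u in P | e v u].
have NP u : u \in N -> (u \in P :\ v) && e v u.
  rewrite !inE => /andP[-> euv]; rewrite euv !andbT.
  by apply: contraTneq euv => ->; rewrite e0.
pose B := f @: (P :\ v) :|: \bigcup_(u in N) nbrs U radj (f u).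
have cB : (#|B| < #|U|)%N.
  have h1 : (#|f @: (P :\ v)| < #|P|)%N.
    by rewrite (cardsD1 v P) vP add1n ltnS leq_imset_card.
  have h2 : (#|\bigcup_(u in N) nbrs U radj (f u)| <= d * D)%N.
    apply: leq_trans (leq_mul degv (leqnn D)).
    rewrite -sum_nat_const.
    apply: (@leq_trans (\sum_(u in N) #|nbrs U radj (f u)|)); last first.
      by apply: leq_sum => u /NP/andP[uP _]; apply/degU/fU.
    elim/big_rec2: _ => [|u A n _ H]; first by rewrite cards0.
    by apply: leq_trans (leq_card_setU _ _) _; rewrite leq_add2l.
  apply: leq_ltn_trans (leq_card_setU _ _) _.
  by apply: leq_trans cP; rewrite -addSn leq_add.
have [w wU wB] : exists2 w, w \in U & w \notin B.
  apply/subsetPn; apply/negP => /subset_leq_card; lia.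
have fw x : x \in P -> x != v -> w != f x.
  move=> xP xv; apply: contraNneq wB => ->; rewrite inE imset_f //.
  by rewrite !inE xv.
have rw x : x \in P -> e v x -> ~~ red (f x) w.
  move=> xP evx; have xN : x \in N by rewrite inE xP.
  have xv : x != v by case/andP: (NP _ xN) => /setD1P[].
  apply: contra wB => r; rewrite inE; apply/orP; right.
  by apply/bigcupP; exists x => //; rewrite inE wU /radj /loopless /= eq_sym fw.
exists (fun x => if x == v then w else f x); split=> [x y xP yP|x xP|x y xP yP].
- case: eqVneq => [->|xv]; case: eqVneq => [->//|yv] //.
  + by move/eqP; rewrite (negbTE (fw _ yP yv)).
  + by move/esym/eqP; rewrite (negbTE (fw _ xP xv)).
  by apply: fI; rewrite !inE ?xv ?yv.
- by case: eqVneq => [//|xv]; apply: fU; rewrite !inE xv.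
case: eqVneq => [->|xv]; case: eqVneq => [->|yv].
- by rewrite e0.
- by rewrite redC; apply: rw.
- by rewrite eC; apply: rw.
by apply: fe; rewrite !inE ?xv ?yv.
Qed.

Lemma has_blue0 U : (0 < #|U|)%N -> has_blue red U e set0.
Proof.
by move=> /card_gt0P[w0 _]; exists (fun=> w0); split=> [x y|x|x y]; rewrite inE.
Qed.

(* If every vertex of [P] has degree at least [d] then [#|P| * d <= 2 * m], so a
   red neighbourhood of size [#|P|], a blue clique, already contains [P];
   otherwise red degrees are below [#|P|] and a minimum degree vertex of [P] can
   be embedded last. *)
Lemma triangle_or_blue U P : ~ has_clique red 3 U -> (0 < #|U|)%N ->
  (#|P| + 2 * num_edges e <= #|U|)%N -> has_blue red U e P.
Proof.
move=> K3 U0; have [n] := ubnP #|P|; elim: n P => // n IH P; rewrite ltnS => cP cU.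
have [->|/set0Pn [v0 v0P]] := eqVneq P set0; first exact: has_blue0.
case: (classic (exists2 w, w \in U & (#|P| <= #|nbrs U radj w|)%N)) => [[w wU cw]|H].
  apply: (has_blue_indep U0 (I := nbrs U radj w)) => //.
  apply/indepP; split=> [x|x y xw yw]; first by rewrite inE => /andP[].
  apply/negP => xy; apply: K3.
  have sw : [set x; y] \subset nbrs U radj w.
    by apply/subsetP => z; rewrite !inE => /orP[/eqP ->|/eqP ->];
       move: xw yw; rewrite !inE.
  have sU := subset_trans sw (nbrs_sub U w).
  apply: (@has_cliqueS _ (w |: [set x; y])).
    by apply/subsetP => z /setU1P[->|/(subsetP sU)].
  apply: (has_clique_nbrs sU wU sw); exists [set x; y]; split=> //.
    by rewrite cards2; case/andP: xy => ->.
  case/andP: xy => nxy rxy a b; rewrite !inE.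
  by move=> /orP[/eqP->|/eqP->] /orP[/eqP->|/eqP->]; rewrite ?eqxx // redC.
case: (arg_minnP (fun v => #|[set u in P | e v u]|) v0P) => v Pv vmin; have vP : v \in P := Pv.
set d := #|[set u in P | e v u]| in vmin.
have hd : (#|P| * d <= 2 * num_edges e)%N by apply: card_mul_degree_le.
have cPv : #|P| = #|P :\ v|.+1 by rewrite (cardsD1 v P) vP add1n.
apply: (@has_blue_extend _ _ v d #|P|.-1) => //.
- apply: IH; lia.
- move=> w wU; rewrite -ltnS prednK; last by rewrite cPv.
  by rewrite ltnNge; apply/negP => cw; apply: H; exists w.
all: by rewrite cPv /= in hd *; lia.
Qed.

(** Vertices of degree at most [d] in the remaining set are peeled off and put back by
    [has_blue_extend]; peeling stops at a set handled by [core]. *)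
Lemma dense_core_blue U d D :
  (0 < #|U|)%N -> {in U, forall w, #|nbrs U radj w| <= D}%N ->
  (#|V| + d * D <= #|U|)%N ->
  (forall P, {in P, forall v, d < #|[set u in P | e v u]|}%N -> has_blue red U e P) ->
  has_blue red U e setT.
Proof.
move=> U0 degU cU core.
suff H n P : (#|P| < n)%N -> has_blue red U e P by apply: H (ltnSn _).
elim: n P => // n IH P; rewrite ltnS => cP.
case: (classic (exists2 v, v \in P & (#|[set u in P | e v u]| <= d)%N)) => [[v vP dv]|H].
  have cPv : #|P| = #|P :\ v|.+1 by rewrite (cardsD1 v P) vP add1n.
  apply: (has_blue_extend vP _ dv degU); first by apply: IH; rewrite -cPv.
  by apply: leq_trans cU; rewrite leq_add2r max_card.
by apply: core => v vP; rewrite ltnNge; apply/negP => dv; apply: H; exists v.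
Qed.

(** If both conclusions fail, [D] bounds red degrees and [k] red codegrees. An independent set of
    size [h] would hold the dense core; without one, [locally_sparse_indep] contradicts the last
    hypothesis. *)
Lemma clique_or_blue_step U s D d h k t :
  (forall X, X \subset U -> D <= #|X| ->
     has_clique red s.+1 X \/ has_blue red X e setT)%N ->
  (forall X, X \subset U -> k <= #|X| -> [\/ has_clique red s X,
     has_blue red X e setT | exists2 I, indep X radj I & h <= #|I|])%N ->
  (0 < k)%N -> (k * 4 ^ t <= D)%N -> (#|V| + d * D <= #|U|)%N ->
  (2 * num_edges e <= h * d.+1)%N -> (16 * D * h < #|U| * t)%N ->
  has_clique red s.+2 U \/ has_blue red U e setT.
Proof.
move=> HD Hk k0 kD cU mh big.
have U0 : (0 < #|U|)%N by case: #|U| big.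
(* A core [P] satisfies [#|P| * d.+1 <= 2 * num_edges e <= h * d.+1], hence fits into [I]. *)
have core : (exists2 I, indep U radj I & h <= #|I|)%N -> forall P,
    {in P, forall v, d < #|[set u in P | e v u]|}%N -> has_blue red U e P.
  case=> I iI hI P /(card_mul_degree_le eG) hP.
  apply: (has_blue_indep U0 iI); apply: leq_trans hI.
  by have := leq_trans hP mh; rewrite leq_pmul2r.
case: (classic (has_clique red s.+2 U)) => [|nK]; [by left|right].
apply: NNPP => nB.
have lift X : X \subset U -> ~ has_blue red X e setT.
  by move=> sX /(has_blueS sX (subxx _)).
have sub w X : w \in U -> X \subset U -> w |: X \subset U.
  by move=> wU sX; rewrite subUset sub1set wU.
have nbK w s' X : w \in U -> X \subset nbrs U radj w -> has_clique red s' X ->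
    has_clique red s'.+1 (w |: X).
  by move=> wU sX; apply: (has_clique_nbrs _ wU sX); apply: subset_trans sX (nbrs_sub _ _).
have degU : {in U, forall w, #|nbrs U radj w| <= D}%N.
  move=> w wU; rewrite leqNgt; apply/negP => /ltnW cw.
  case: (HD _ (nbrs_sub U w) cw) => [|/(lift _ (nbrs_sub _ _))//].
  by move/(nbK _ _ _ wU (subxx _))/(has_cliqueS (sub _ _ wU (nbrs_sub _ _))).
apply/nB/(dense_core_blue U0 degU cU)/core; apply: NNPP => nI.
have small I : indep U radj I -> (#|I| <= h)%N.
  by move=> iI; rewrite leqNgt; apply/negP => /ltnW hI; apply: nI; exists I.
have codU : {in U &, forall w x, radj w x -> #|nbrs U radj w :&: nbrs U radj x| < k}%N.
  move=> w x wU xU wx; rewrite ltnNge; apply/negP => cX.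
  set X := _ :&: _ in cX.
  have sX : X \subset U by apply: subset_trans (subsetIl _ _) (nbrs_sub _ _).
  (* A clique in the common neighbourhood grows by [x] and then by [w]; an independent set found
     there is independent in [U] too. *)
  case: (Hk X sX cX) => [|/(lift _ sX)//|[I /indepP[sI nIe] hI]]; last first.
    apply: nI; exists I => //; apply/indepP; split=> // y /sI; exact: (subsetP sX).
  move/(nbK _ _ _ xU (subsetIr _ _)) => H; apply: nK.
  have sxX : x |: X \subset nbrs U radj w by rewrite subUset subsetIl sub1set inE xU andbT.
  exact: has_cliqueS (sub _ _ wU (sub _ _ xU sX)) (nbK _ _ _ wU sxX H).
have := locally_sparse_indep looplessC loopless_irr k0 kD degU codU small.
by rewrite leqNgt big.
Qed.
End Embed.

From Stdlib Require Import Reals Lra.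

(** * Choice of parameters and real estimates *)

Section Asymptotics.
Local Open Scope R_scope.

(** As [up x] is strictly above [x], this overshoots by 1 at integers; the slack of 1 is absorbed
    everywhere. *)
Definition nat_ceil (x : R) : nat := Z.to_nat (up x).

Lemma nat_ceilP x : 0 <= x -> x <= INR (nat_ceil x) <= x + 1.
Proof.
move=> x0; have [h1 h2] := archimed x.
have u0 : (0 <= up x)%Z by apply: le_IZR; Lra.lra.
by rewrite /nat_ceil INR_IZR_INZ Znat.Z2Nat.id //; Lra.lra.
Qed.

Lemma le_INR_leq (a b : nat) : INR a <= INR b -> (a <= b)%nat.
Proof. by move/INR_le/leP. Qed.

Lemma lt_INR_ltn (a b : nat) : INR a < INR b -> (a < b)%nat.
Proof. by move/INR_lt/ltP. Qed.

Lemma leq_INR (a b : nat) : (a <= b)%nat -> INR a <= INR b.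
Proof. by move/leP; apply: le_INR. Qed.

Definition growth (m : nat) : R := sqrt (INR m / ln (INR m)).

Section Growth.
Variable (m : nat).
Hypothesis (m2 : (2 <= m)%nat).
Let x := INR m.
Let L := ln x.
Let g := growth m.

Lemma INR_ge2 : 2 <= x.
Proof. by have := leq_INR m2; rewrite /x /=; Lra.lra. Qed.

Lemma ln_ge_half : 1 / 2 < L.
Proof.
have := ln_lt_2; have [/(ln_increasing 2 x Rlt_0_2)|E] := INR_ge2; rewrite /L -?E; Lra.lra.
Qed.

Lemma exp_ln_INR : exp L = x.
Proof. by rewrite exp_ln //; have := INR_ge2; Lra.lra. Qed.

Lemma growth_sqr : g * g * L = x.
Proof.
have L0 := ln_ge_half; have x2 := INR_ge2.
have q0 : 0 <= x / L by apply: Rlt_le; apply: Rdiv_lt_0_compat; Lra.lra.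
by rewrite /g /growth sqrt_sqrt // -/x -/L; field; Lra.lra.
Qed.

(** This is [m^(1/4) <= g], the power of [m] by which codegrees fall below degrees. It reduces to
    [L <= exp (L / 2)], which follows from [L <= (1 + L / 4)^2]. *)
Lemma growth_ge_exp : exp (L / 4) <= g.
Proof.
have L0 := ln_ge_half; have x2 := INR_ge2.
rewrite /g /growth -[exp _]sqrt_Rsqr; last exact: Rlt_le (exp_pos _).
apply: sqrt_le_1_alt; rewrite /Rsqr -exp_plus -/x -/L.
apply: (Rmult_le_reg_r L); first Lra.lra.
have -> : x / L * L = exp (L / 4 + L / 4) * exp (L / 4 + L / 4).
  rewrite -exp_plus -[LHS]/(x / L * L) -{1}exp_ln_INR.
  have -> : L / 4 + L / 4 + (L / 4 + L / 4) = L by field.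
  by field; Lra.lra.
apply: Rmult_le_compat_l; first exact: Rlt_le (exp_pos _).
rewrite exp_plus; have := exp_ineq1_le (L / 4); move: (exp (L / 4)) => y h.
have : (1 + L / 4) * (1 + L / 4) <= y * y by apply: Rmult_le_compat; Lra.lra.
have := Rle_0_sqr (1 - L / 4); rewrite /Rsqr; Lra.lra.
Qed.

Lemma growth_ge1 : 1 <= g.
Proof.
apply: Rle_trans growth_ge_exp; have := exp_ineq1_le (L / 4).
by have := ln_ge_half; Lra.lra.
Qed.

Lemma growth_le : g <= x.
Proof.
have g1 := growth_ge1; have L0 := ln_ge_half; have E := growth_sqr.
have x2 := INR_ge2.
have h : g * g <= x * x.
  have gg : g * g <= 2 * x by rewrite -E; Lra.nra.
  by Lra.nra.
by Lra.nra.
Qed.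

Lemma div_growth : x / g = g * L.
Proof. by have g1 := growth_ge1; rewrite -{1}growth_sqr; field; Lra.lra. Qed.

Lemma pow_growth_ge1 j : 1 <= g ^ j.
Proof. by apply: pow_R1_Rle; apply: growth_ge1. Qed.

(** Rewrites the bound of the theorem for [s = j + 3], by comparing exponents through
    [ln g = (L - ln L) / 2]. *)
Lemma Rpower_growth j : Rpower x ((INR (j + 3) - 1) / 2) /
  Rpower L ((INR (j + 3) - 3) / 2) = x * g ^ j.
Proof.
have L0 := ln_ge_half; have x2 := INR_ge2; have g1 := growth_ge1.
have lg : ln g = (L - ln L) / 2.
  have : ln (g * g * L) = L by rewrite growth_sqr.
  by rewrite !ln_mult; try Lra.lra; Lra.nra.
rewrite -Rpower_pow; last Lra.lra.
rewrite /Rpower lg -{2}exp_ln_INR -exp_plus plus_INR -/L.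
rewrite /Rdiv -exp_Ropp -exp_plus; congr exp; rewrite /=; field.
Qed.
End Growth.

Definition clique_bound (j : nat) : Prop :=
  exists c : R, 0 < c /\ forall m, (2 <= m)%nat ->
  forall (V : finType) (e : rel V), simple_graph e -> num_edges e = m ->
  no_isolated e ->
  exists n, arrows (j + 3) e n /\ INR n <= c * (INR m * growth m ^ j).

(* Bounds the order of a graph with [m] edges and minimum degree [>= growth m]. *)
Definition core_size (m : nat) : nat := nat_ceil (2 * INR m / growth m).

(** Dividing by [growth m] expresses the exponent [j - 1] also at [j = 0], where the third outcome
    covers sets without red edges. *)
Definition codegree_bound (j : nat) : Prop :=
  exists c : R, 0 < c /\ forall m, (2 <= m)%nat ->
  forall (V : finType) (e : rel V), simple_graph e -> num_edges e = m ->
  no_isolated e ->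
  exists k, [/\ (0 < k)%nat, INR k <= c * (INR m * growth m ^ j / growth m) &
    forall (W : finType) (red : rel W) (U : {set W}), symmetric red ->
    (k <= #|U|)%nat -> [\/ has_clique red (j + 2) U, has_blue red U e setT |
      exists2 I, indep U (loopless red) I & (core_size m <= #|I|)%nat]].

Lemma clique_bound0 : clique_bound 0.
Proof.
exists 4; split=> [|m m2 V e eG em ni]; first Lra.lra.
(* [2 m] bounds the number of vertices of the graph, and [triangle_or_blue] asks for another
   [2 m]. *)
exists (4 * m)%nat; split.
  move=> W red U redC cU.
  case: (classic (has_clique red 3 U)) => [|nK]; [by left|right].
  apply: triangle_or_blue => //; first by apply: leq_trans cU; case: m m2 {em}.
  rewrite cardsT em; have := no_isolated_card_le eG ni; rewrite em => h.
  by apply: leq_trans cU; apply: leq_trans (leq_add h (leqnn _)) _; rewrite -mulnDl.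
by rewrite -multE mult_INR /=; Lra.lra.
Qed.

Lemma core_sizeP m : (2 <= m)%nat ->
  2 * INR m / growth m <= INR (core_size m) <= 3 * (INR m / growth m).
Proof.
move=> m2; have x2 := INR_ge2 m2; have g1 := growth_ge1 m2.
have gx := growth_le m2.
have h0 : 1 <= INR m / growth m.
  by apply: (Rmult_le_reg_r (growth m)); first Lra.lra; rewrite /Rdiv Rmult_assoc Rinv_l; Lra.lra.
have := @nat_ceilP (2 * INR m / growth m); rewrite -/(core_size m).
have -> : 2 * INR m / growth m = 2 * (INR m / growth m) by field; Lra.lra.
by move=> h; have := h ltac:(Lra.lra); Lra.lra.
Qed.

Lemma codegree_bound0 : codegree_bound 0.
Proof.
exists 3; split=> [|m m2 V e eG em ni]; first Lra.lra.
have [h1 h2] := core_sizeP m2.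
have x2 := INR_ge2 m2; have g1 := growth_ge1 m2.
exists (core_size m); split.
- apply: lt_INR_ltn; apply: Rlt_le_trans h1; apply: Rdiv_lt_0_compat => /=; Lra.lra.
- by rewrite /= Rmult_1_r.
move=> W red U redC cU.
case: (classic (exists x, exists y, [/\ x \in U, y \in U & loopless red x y])).
  case=> x [y [xU yU /andP[xy rxy]]]; constructor 1; exists [set x; y].
  split; first by rewrite subUset !sub1set xU.
    by rewrite cards2 xy.
  move=> a b; rewrite !inE.
  by move=> /orP[/eqP->|/eqP->] /orP[/eqP->|/eqP->]; rewrite ?eqxx // redC.
move=> H; constructor 3; exists U => //; apply/indepP; split=> // x y xU yU.
by apply/negP => r; apply: H; exists x, y.
Qed.

(** The clique sizes agree, as [j.+1 + 2 = j + 3]. Taking [n.+1] ensures positivity, at the cost of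
    1 in the constant. *)
Lemma codegree_boundS j : clique_bound j -> codegree_bound j.+1.
Proof.
case=> c [c0 H]; exists (c + 1); split=> [|m m2 V e eG em ni]; first Lra.lra.
have [n [An nc]] := H m m2 V e eG em ni.
have x2 := INR_ge2 m2; have g1 := growth_ge1 m2; have gj := pow_growth_ge1 m2 j.
exists n.+1; split=> //.
  have -> : INR m * growth m ^ j.+1 / growth m = INR m * growth m ^ j.
    by rewrite /=; field; Lra.lra.
  by rewrite S_INR; Lra.nra.
move=> W red U redC /ltnW cU; rewrite addSnnS.
by case: (An W red U redC cU) => ?; [constructor 1|constructor 2].
Qed.

(** Peeling with threshold [d = #|V|] never stops early, so only the empty core remains. This
    recursion serves for bounded [m]. *)
Lemma arrows_crude (V : finType) (e : rel V) s n : simple_graph e ->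
  (0 < #|V|)%nat -> arrows s e n -> arrows s.+1 e (#|V| + #|V| * n).
Proof.
move=> eG V0 An W red U redC cU.
have U0 : (0 < #|U|)%nat by apply: leq_trans V0 (leq_trans (leq_addr _ _) cU).
case: (classic (has_clique red s.+1 U)) => [|nK]; [by left|right].
apply: NNPP => nB.
apply: (nB); apply: (dense_core_blue redC eG (D := n) U0 _ cU) => [w wU|P HP].
  rewrite leqNgt; apply/negP => /ltnW cw.
  have sN := nbrs_sub red U w.
  case: (An W red _ redC cw) => [K|B]; last first.
    by apply: nB; apply: has_blueS (subxx _) B.
  apply: nK; apply: has_cliqueS (has_clique_nbrs redC sN wU (subxx _) K).
  by rewrite subUset sub1set wU.
suff -> : P = set0 by apply: has_blue0.
apply/setP => v; rewrite inE; apply/negP => /HP.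
by rewrite ltnNge max_card.
Qed.

(** The step is applied with [D] about [c1 y], [d] about [g] and [t] about [L / 32], where
    [y = m g^j]. The lower bound on [L] makes [4 ^ t] and [c2 / c1] each at most [exp (L / 8)], and
    their product is at most [g]. *)
Lemma clique_boundS_large j c1 c2 :
  0 < c1 -> 0 < c2 ->
  forall m, (2 <= m)%nat -> 32 + 8 * c2 / c1 <= ln (INR m) ->
  forall (V : finType) (e : rel V) n k, simple_graph e -> num_edges e = m ->
  no_isolated e ->
  arrows (j + 3) e n -> INR n <= c1 * (INR m * growth m ^ j) ->
  (0 < k)%nat -> INR k <= c2 * (INR m * growth m ^ j / growth m) ->
  (forall (W : finType) (red : rel W) (U : {set W}), symmetric red ->
    (k <= #|U|)%nat -> [\/ has_clique red (j + 2) U, has_blue red U e setT |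
      exists2 I, indep U (loopless red) I & (core_size m <= #|I|)%nat]) ->
  exists N, arrows (j.+1 + 3) e N /\
    INR N <= (1537 * (c1 + 1) + 1) * (INR m * growth m ^ j.+1).
Proof.
move=> c10 c20 m m2 mL V e n k eG em ni An nc k0 kc Hk.
have := core_sizeP m2; have := INR_ge2 m2; have := growth_ge1 m2.
have := pow_growth_ge1 m2 j; have := div_growth m2; have := growth_ge_exp m2.
have cV : INR #|V| <= 2 * INR m.
  have := no_isolated_card_le eG ni; rewrite em => /leq_INR.
  by rewrite -multE mult_INR.
move: mL nc kc cV; rewrite [growth m ^ j.+1]/=.
set x := INR m; set L := ln x; set g := growth m; set h := core_size m.
move=> mL nc kc cV gE xg gj g1 x2 [h1 h2].
set y := x * g ^ j in nc kc.
have y1 : 1 <= y by rewrite /y; Lra.nra.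
have yx : x <= y by rewrite /y; Lra.nra.
have -> : x * (g * g ^ j) = y * g by rewrite /y; ring.
have cc : 0 < c2 / c1 by apply: Rdiv_lt_0_compat.
have [D1 D2] := @nat_ceilP (c1 * y) ltac:(Lra.nra).
have [d1 d2] := @nat_ceilP g ltac:(Lra.lra).
have yg1 : 1 <= y * g by rewrite -[1]Rmult_1_r; apply: Rmult_le_compat; Lra.lra.
have b0 : 0 <= 1537 * (c1 + 1) * (y * g) by apply: Rmult_le_pos; Lra.lra.
have [N1 N2] := nat_ceilP b0.
have [t1 t2] := @nat_ceilP (L / 32) ltac:(rewrite -/x -/L in mL; Lra.lra).
set D := nat_ceil (c1 * y) in D1 D2; set d := nat_ceil g in d1 d2.
set N := nat_ceil _ in N1 N2; set t := nat_ceil _ in t1 t2.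
exists N; split; last by Lra.lra.
move=> W red U redC cU.
have L32 : 32 <= L by Lra.lra.
have U1 := leq_INR cU.
rewrite addSn addnS; apply: (@clique_or_blue_step _ _ _ _ redC eG _ _ D d h k t) => //.
- move=> X _ cX; rewrite -addnS; apply: An => //; apply: leq_trans cX.
  by apply: le_INR_leq; Lra.lra.
- by move=> X _ cX; apply: Hk.
- apply: le_INR_leq; rewrite -multE mult_INR.
  (* Uses [4 <= exp 2] and [t <= L / 32 + 1 <= L / 16]. *)
  have t4 : INR (expn 4 t) <= exp (L / 8).
    apply: (@Rle_trans _ (exp (INR t * 2))); last first.
      by case: (Rle_lt_or_eq_dec (INR t * 2) (L / 8) ltac:(Lra.lra)) => [/exp_increasing|->]; Lra.lra.
    elim: (t) => [|i IH]; first by rewrite Rmult_0_l exp_0 /=; Lra.lra.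
    rewrite expnS -multE mult_INR (S_INR i) Rmult_plus_distr_r exp_plus Rmult_comm.
    apply: Rmult_le_compat => //; try exact: pos_INR.
    have -> : 1 * 2 = 1 + 1 by ring.
    rewrite exp_plus; have := exp_ineq1_le 1; rewrite /=; Lra.nra.
  have e8 : c2 / c1 <= exp (L / 8).
    have E : 8 * c2 / c1 = 8 * (c2 / c1) by field; Lra.lra.
    by apply: Rle_trans (exp_ineq1_le _); Lra.lra.
  have e0 := exp_pos (L / 8).
  have gE8 : exp (L / 8) * exp (L / 8) <= g.
    by rewrite -exp_plus; have -> : L / 8 + L / 8 = L / 4 by field.
  apply: Rle_trans D1.
  apply: (@Rle_trans _ (c2 * (y / g) * exp (L / 8))).
    by apply: Rmult_le_compat => //; apply: pos_INR.
  have -> : c2 * (y / g) * exp (L / 8) = (c2 * exp (L / 8)) * (y / g) by ring.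
  have -> : c1 * y = (c1 * g) * (y / g) by field; Lra.lra.
  apply: Rmult_le_compat_r; first by apply: Rlt_le; apply: Rdiv_lt_0_compat; Lra.lra.
  have : c2 <= c1 * exp (L / 8).
    have E : c1 * (c2 / c1) = c2 by field; Lra.lra.
    by rewrite -{1}E; apply: Rmult_le_compat_l => //; apply: Rlt_le.
  by Lra.nra.
- apply: leq_trans cU; apply: le_INR_leq; rewrite -plusE -multE plus_INR mult_INR.
  have : INR d * INR D <= (2 * g) * ((c1 + 1) * y).
    by apply: Rmult_le_compat; try exact: pos_INR; Lra.nra.
  by Lra.nra.
- rewrite em; apply: le_INR_leq; rewrite -!multE !mult_INR (S_INR d) -/x.
  have : 2 * x / g * g <= INR h * (INR d + 1).
    have : 0 < 2 * x / g by apply: Rdiv_lt_0_compat; Lra.lra.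
    by move=> ?; apply: Rmult_le_compat; Lra.lra.
  have -> : 2 * x / g * g = 2 * x by field; Lra.lra.
  by rewrite /=; Lra.lra.
(* The left side is at most [48 (c1 + 1) y g L], the right at least [1537 / 32] times
   [(c1 + 1) y g L]; [1537 = 32 * 48 + 1] gives strictness. *)
apply: lt_INR_ltn; rewrite -!multE !mult_INR.
have a1 : INR D * INR h <= ((c1 + 1) * y) * (3 * (g * L)).
  by apply: Rmult_le_compat; try exact: pos_INR; rewrite -?xg; Lra.nra.
have a2 : (1537 * (c1 + 1) * (y * g)) * (L / 32) <= INR #|U| * INR t.
  apply: Rmult_le_compat; try Lra.lra; Lra.nra.
have a3 : 0 < (c1 + 1) * (y * g) * L.
  by repeat (apply: Rmult_lt_0_compat); Lra.lra.
rewrite [INR 16]INR_IZR_INZ /=; Lra.lra.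
Qed.

Lemma clique_boundS j : clique_bound j -> codegree_bound j -> clique_bound j.+1.
Proof.
case=> c1 [c10 A] [c2 [c20 B]].
pose L0 := 32 + 8 * c2 / c1.
pose K := 2 * exp L0 * (c1 + 1).
have K0 : 0 < K.
  by rewrite /K; have := exp_pos L0; move: (exp L0) => z z0; Lra.nra.
exists (1537 * (c1 + 1) + 1 + K); split=> [|m m2 V e eG em ni]; first by Lra.lra.
have [n [An nc]] := A m m2 V e eG em ni.
have x2 := INR_ge2 m2; have g1 := growth_ge1 m2.
have gj := pow_growth_ge1 m2 j; have gj1 := pow_growth_ge1 m2 j.+1.
have y0 : 0 < INR m * growth m ^ j.+1 by apply: Rmult_lt_0_compat; Lra.lra.
have [mL|/Rnot_le_lt mL] := classic (L0 <= ln (INR m)).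
  have [k [k0 kc Hk]] := B m m2 V e eG em ni.
  have [N [AN Nc]] :=
    clique_boundS_large c10 c20 m2 mL eG em ni An nc k0 kc Hk.
  by exists N; split=> //; Lra.nra.
(* Here [m < exp L0] is bounded, so the factor [#|V| <= 2 m] lost by [arrows_crude] goes into the
   constant [K]. *)
have cV := no_isolated_card_le eG ni.
have V0 : (0 < #|V|)%nat.
  have /card_gt0P[Q] : (0 < num_edges e)%nat by rewrite em ltnW.
  by rewrite inE => /existsP[v _]; apply/card_gt0P; exists v.
exists (#|V| + #|V| * n)%nat; split; first by rewrite addSn; apply: arrows_crude.
rewrite -plusE -multE plus_INR mult_INR.
have xL : INR m <= exp L0.
  by rewrite -(exp_ln_INR m2); apply: Rlt_le; apply: exp_increasing.
move: cV; rewrite em => /leq_INR; rewrite -multE mult_INR [INR 2]/= => cV.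
have h1 : INR #|V| * (1 + INR n) <=
    (2 * exp L0) * ((c1 + 1) * (INR m * growth m ^ j)).
  apply: Rmult_le_compat; try exact: pos_INR; try Lra.lra.
    by have := pos_INR n; Lra.lra.
  by Lra.nra.
have h2 : INR m * growth m ^ j <= INR m * growth m ^ j.+1.
  by apply: Rmult_le_compat_l; [|rewrite /=]; Lra.nra.
have h3 : (2 * exp L0) * ((c1 + 1) * (INR m * growth m ^ j)) <=
    K * (INR m * growth m ^ j.+1).
  by rewrite /K -Rmult_assoc; apply: Rmult_le_compat_l => //; apply: Rlt_le.
by Lra.nra.
Qed.

(** Both bounds advance together: the clique bound at [j.+1] needs both at [j], and the codegree
    bound at [j.+1] is the clique bound at [j]. *)
Lemma clique_boundP j : clique_bound j.
Proof.
suff [] : clique_bound j /\ codegree_bound j by [].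
elim: j => [|j [A B]]; first by split; [apply: clique_bound0|apply: codegree_bound0].
by split; [apply: clique_boundS|apply: codegree_boundS].
Qed.
End Asymptotics.

(* r(K_s,G) <= B  iff  some n <= B has the Ramsey property (r is the least such n). *)
Theorem theorem2 :
  forall s : nat, (3 <= s)%N ->
  exists c : R, (0 < c)%R /\
    forall (m : nat), (2 <= m)%N ->
    forall (V : finType) (e : rel V),
      simple_graph e -> num_edges e = m -> no_isolated e ->
      exists n : nat, ramsey_prop s e n /\
        (INR n <= c * (Rpower (INR m) ((INR s - 1) / 2)
                       / Rpower (ln (INR m)) ((INR s - 3) / 2)))%R.
Proof.
move=> s s3; have [c [c0 H]] := clique_boundP (s - 3).
exists c; split=> // m m2 V e eG em ni.
have [n [An nc]] := H m m2 V e eG em ni.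
exists n; split; first by apply: arrows_ramsey; rewrite -(subnK s3).
by rewrite -(Rpower_growth m2) subnK in nc.
Qed.
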